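(* Let $\mathsf{M}_2$ be the space of $2\times 2$ complex matrices and $\mathsf{M}_2^+$ the cone of positive semidefinite matrices in it. Then $\gamma(\mathsf{M}_2^+) = 4$ and $\gamma^{\mathrm{cp}}(\mathsf{M}_2^+) = 3$.
   Context: Regard $\mathsf{M}_2^+$ as a proper cone in the real vector space of $2\times 2$ Hermitian matrices (linear maps $\Phi$ on $\mathsf{M}_2$ preserving Hermiticity act on it). A linear map $\Phi$ is $\mathsf{M}_2^+$-positive if $\Phi(\mathsf{M}_2^+) \subset \mathsf{M}_2^+$, strictly $\mathsf{M}_2^+$-positive if it maps $\mathsf{M}_2^+\setminus\{0\}$ into the interior of $\mathsf{M}_2^+$ (the positive definite matrices), and $\mathsf{M}_2^+$-primitive if it is $\mathsf{M}_2^+$-positive and some power $\Phi^k$ ($k \geq 1$) is strictly $\mathsf{M}_2^+$-positive; $\gamma(\mathsf{M}_2^+,\Phi)$ is the smallest such $k$. The maximal exponent $\gamma(\mathsf{M}_2^+)$ is the supremum of $\gamma(\mathsf{M}_2^+,\Phi)$ over all $\mathsf{M}_2^+$-primitive linear maps $\Phi$, and $\gamma^{\mathrm{cp}}(\mathsf{M}_2^+)$ is the supremum of $\gamma(\mathsf{M}_2^+,\Phi)$ over all linear maps $\Phi : \mathsf{M}_2 \to \mathsf{M}_2$ that are completely positive and $\mathsf{M}_2^+$-primitive. *)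

(* Defs.v *)
From HB Require Import structures.
From mathcomp Require Import all_boot all_order all_algebra.
From mathcomp Require Import complex.
From mathcomp Require Import Rstruct.
From Stdlib Require Rdefinitions.
Set Implicit Arguments. Unset Strict Implicit. Unset Printing Implicit Defensive.
Import Order.TTheory GRing.Theory Num.Theory.
Local Open Scope ring_scope.

Notation C := (complex Rdefinitions.R).

Definition adjmx (m n : nat) (A : 'M[C]_(m, n)) : 'M[C]_(n, m) :=
  (map_mx Num.conj A)^T.

Definition hermitian (n : nat) (A : 'M[C]_n) : Prop := adjmx A = A.

Definition psd (n : nat) (A : 'M[C]_n) : Prop :=
  hermitian A /\ forall v : 'cV[C]_n, 0 <= (adjmx v *m A *m v) 0 0.

Definition pd (n : nat) (A : 'M[C]_n) : Prop :=
  hermitian A /\ forall v : 'cV[C]_n, v != 0 -> 0 < (adjmx v *m A *m v) 0 0.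

Notation M2 := 'M[C]_2.

Definition herm_preserving (Phi : M2 -> M2) : Prop :=
  forall A : M2, hermitian A -> hermitian (Phi A).

Definition M2pos_positive (Phi : M2 -> M2) : Prop :=
  forall A : M2, psd A -> psd (Phi A).

(* strictly M_2^+-positive: Phi maps M_2^+ \ {0} into the interior of M_2^+,
   i.e. into the positive definite matrices *)
Definition M2pos_strictly_positive (Phi : M2 -> M2) : Prop :=
  forall A : M2, psd A -> A != 0 -> pd (Phi A).

Definition mpow (Phi : M2 -> M2) (k : nat) : M2 -> M2 := iter k Phi.

Definition M2pos_primitive (Phi : M2 -> M2) : Prop :=
  M2pos_positive Phi /\
  exists k : nat, (1 <= k)%N /\ M2pos_strictly_positive (mpow Phi k).

Definition exponent_is (Phi : M2 -> M2) (k : nat) : Prop :=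
  [/\ (1 <= k)%N, M2pos_strictly_positive (mpow Phi k) &
      forall j : nat, (1 <= j)%N -> (j < k)%N ->
        ~ M2pos_strictly_positive (mpow Phi j)].

(* complete positivity: for every n, id_n (x) Phi maps positive semidefinite
   elements of M_n(M_2) (n x n block matrices with 2x2 blocks) to positive
   semidefinite ones *)
Definition completely_positive (Phi : M2 -> M2) : Prop :=
  forall (n : nat) (X : 'I_n -> 'I_n -> M2),
    psd (\mxblock_(i < n, j < n) X i j) ->
    psd (\mxblock_(i < n, j < n) Phi (X i j)).

Definition max_exponent_is (S : (M2 -> M2) -> Prop) (g : nat) : Prop :=
  (forall Phi, S Phi -> M2pos_primitive Phi ->
     forall k, exponent_is Phi k -> (k <= g)%N) /\
  (exists Phi, [/\ S Phi, M2pos_primitive Phi & exponent_is Phi g]).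

(* the class of linear maps on M_2 preserving Hermiticity (i.e. real-linear
   maps on the Hermitian matrices) *)
Definition lin_herm_maps (Phi : M2 -> M2) : Prop :=
  linear Phi /\ herm_preserving Phi.

Definition cp_maps (Phi : M2 -> M2) : Prop :=
  linear Phi /\ completely_positive Phi.

(* Main.v *)
(** Let [x_n = Phi^n x], where [x] is a rank-one state such that [x_0, ..., x_4]
    are all singular.  If [x_j] and [x_{j+1}] are both singular, then [x_j] is a
    boundary minimum of [det o Phi] on the cone, so [B (Phi x_j) (Phi z)] is
    [mu * B x_j z] for all [z], where [B] is the polar form of [det]; the symmetry
    of [B] makes [mu] independent of [j].  The solutions [x] of this equation form
    a linear subspace which contains [x_0, ..., x_3], hence by Cayley-Hamilton the
    whole orbit, and there [det (Phi x) = mu * det x].  So the orbit never becomes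
    positive definite, and the exponent is at most 4.

    If [Phi] is completely positive, [Phi (v v^* )] is singular iff [u v^*] is in
    the kernel of the (positive semidefinite) Choi form for some [u <> 0].  If
    three pairwise independent [v_i] admit such [u_i], every [v] does, so three
    singular steps make the whole orbit singular; if two of the three states are
    proportional, the orbit is periodic up to scaling.  The exponent is at most 3.

    The bounds are attained by [A |-> G ((A + A^T) / 2) G^*], with
    [G = [[0, i], [1, i]]], and by [A |-> A_00 e1 e1^* + A_11 f f^*], with
    [f = e0 + e1]. *)

From HB Require Import structures.
Require Import Defs.
From mathcomp Require Import all_boot all_order all_algebra.
From mathcomp Require Import complex Rstruct ring.
From mathcomp Require boolp.
Set Implicit Arguments. Unset Strict Implicit. Unset Printing Implicit Defensive.
Import Order.TTheory GRing.Theory Num.Theory.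
Local Open Scope ring_scope.

(** * Forms, cross products and rank-one matrices in dimension two *)

Definition sesq (x : 'cV[C]_2) (A : M2) (y : 'cV[C]_2) : C := (adjmx x *m A *m y) 0 0.
Definition qf (u : 'cV[C]_2) (A : M2) : C := (adjmx u *m A *m u) 0 0.
Definition dot (u v : 'cV[C]_2) : C := (u 0 0)^* * v 0 0 + (u 1 0)^* * v 1 0.
Definition cross (v w : 'cV[C]_2) : C := v 0 0 * w 1 0 - v 1 0 * w 0 0.
Definition ou (v w : 'cV[C]_2) : M2 := v *m adjmx w.
Definition cv (a b : C) : 'cV[C]_2 := \col_i (if i == 0 then a else b).
(** Spans the orthogonal complement of [v]; the conjugates are placed so that [dot (perp v) w] is
    the bilinear [cross v w]. *)
Definition perp (v : 'cV[C]_2) : 'cV[C]_2 := cv (- (v 1 0)^*) (v 0 0)^*.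
(* The polar form of the determinant, normalised by [polar A A = 2 * \det A]. *)
Definition polar (A X : M2) : C :=
  A 0 0 * X 1 1 + A 1 1 * X 0 0 - A 0 1 * X 1 0 - A 1 0 * X 0 1.

Lemma ord2P (P : 'I_2 -> Prop) : P 0 -> P 1 -> forall i, P i.
Proof.
move=> p0 p1 [[|[|k]] hk] //.
  by rewrite (_ : Ordinal hk = 0) //; apply/val_inj.
by rewrite (_ : Ordinal hk = 1) //; apply/val_inj.
Qed.

Lemma sum2E (F : 'I_2 -> C) : \sum_i F i = F 0 + F 1.
Proof.
rewrite !big_ord_recl big_ord0 addr0; congr (_ + F _); exact/val_inj.
Qed.

Lemma mx2P (A X : M2) :
  A 0 0 = X 0 0 -> A 0 1 = X 0 1 -> A 1 0 = X 1 0 -> A 1 1 = X 1 1 -> A = X.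
Proof. by move=> *; apply/matrixP; apply: ord2P; apply: ord2P. Qed.

Lemma cv2P (u v : 'cV[C]_2) : u 0 0 = v 0 0 -> u 1 0 = v 1 0 -> u = v.
Proof. by move=> *; apply/matrixP; apply: ord2P => j; rewrite (ord1 j). Qed.

Lemma cv2_neq0 (v : 'cV[C]_2) : v != 0 -> (v 0 0 != 0) || (v 1 0 != 0).
Proof.
apply: contraNT; rewrite negb_or !negbK => /andP[/eqP a /eqP b].
by apply/eqP/cv2P; rewrite ?a ?b mxE.
Qed.

Lemma adjmxE (m n : nat) (A : 'M[C]_(m, n)) i j : adjmx A i j = (A j i)^*.
Proof. by rewrite !mxE. Qed.

Lemma sesqE x A y : sesq x A y = (x 0 0)^* * A 0 0 * y 0 0 + (x 1 0)^* * A 1 0 * y 0 0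
  + (x 0 0)^* * A 0 1 * y 1 0 + (x 1 0)^* * A 1 1 * y 1 0.
Proof. by rewrite /sesq mxE sum2E !mxE !sum2E !adjmxE; ring. Qed.

Lemma qfE u A : qf u A =
  (u 0 0)^* * A 0 0 * u 0 0 + (u 1 0)^* * A 1 0 * u 0 0
  + (u 0 0)^* * A 0 1 * u 1 0 + (u 1 0)^* * A 1 1 * u 1 0.
Proof. exact: sesqE. Qed.

Lemma ouE v w i j : ou v w i j = v i 0 * (w j 0)^*.
Proof. by rewrite mxE big_ord1 adjmxE. Qed.

Lemma cv0E a b : cv a b 0 0 = a. Proof. by rewrite mxE. Qed.
Lemma cv1E a b : cv a b 1 0 = b. Proof. by rewrite mxE. Qed.
Lemma perp0E v : perp v 0 0 = - (v 1 0)^*. Proof. by rewrite mxE. Qed.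
Lemma perp1E v : perp v 1 0 = (v 0 0)^*. Proof. by rewrite mxE. Qed.

Lemma det2E (A : M2) : \det A = A 0 0 * A 1 1 - A 0 1 * A 1 0.
Proof.
rewrite (expand_det_row _ 0) sum2E /cofactor !det_mx11 !mxE /=.
have -> : lift (0 : 'I_2) 0 = 1 by apply/val_inj.
have -> : lift (1 : 'I_2) 0 = 0 by apply/val_inj.
have -> : (-1) ^+ (0 + 1 %% 2) = -1 :> C by [].
have -> : (-1) ^+ (0 + 0) = 1 :> C by [].
by rewrite mul1r mulN1r mulrN.
Qed.

Lemma polar_self A : polar A A = 2 * \det A.
Proof. rewrite /polar det2E; ring. Qed.

Lemma polarC A X : polar A X = polar X A. Proof. rewrite /polar; ring. Qed.

Lemma polar_linear A : scalar (polar A).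
Proof. by move=> a X Y; rewrite /polar !mxE; ring. Qed.
HB.instance Definition _ A := GRing.isLinear.Build C M2 C *%R (polar A) (polar_linear A).

Lemma qf_linear u : scalar (qf u).
Proof. by move=> a X Y; rewrite /qf mulmxDr mulmxDl -scalemxAr -scalemxAl !mxE. Qed.
HB.instance Definition _ u := GRing.isLinear.Build C M2 C *%R (qf u) (qf_linear u).

(** Translates pairings under the polar form of [\det] into values of quadratic forms, where
    positivity can be used. *)
Lemma polar_ou v X : polar (ou v v) X = qf (perp v) X.
Proof. rewrite /polar qfE !ouE perp0E perp1E !rmorphN /= !conjCK; ring. Qed.

Lemma cv_combE a b (v w : 'cV[C]_2) i : (a *: v + b *: w) i 0 = a * v i 0 + b * w i 0.
Proof. by rewrite !mxE. Qed.

Lemma dot_perpl v w : dot (perp v) w = cross v w.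
Proof. by rewrite /dot /cross !(perp0E, perp1E) rmorphN /= !conjCK; ring. Qed.

Lemma crossvv v : cross v v = 0.
Proof. by rewrite /cross; ring. Qed.

Lemma crossC v w : cross v w = - cross w v.
Proof. by rewrite /cross; ring. Qed.

Lemma cross_comb a b u v w : cross (a *: u + b *: v) w = a * cross u w + b * cross v w.
Proof.
have E i : (a *: u + b *: v) i 0 = a * u i 0 + b * v i 0 by rewrite !mxE.
by rewrite /cross !E; ring.
Qed.

Lemma cross_span v w x : cross v w != 0 -> exists a b, x = a *: v + b *: w.
Proof.
move=> d0; exists (cross x w / cross v w), (cross v x / cross v w).
by apply: cv2P; rewrite cv_combE; move: d0; rewrite /cross => d0; field; exact: d0.
Qed.

Lemma perp_eq0 v : (perp v == 0) = (v == 0).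
Proof.
apply/eqP/eqP => [h|->]; last first.
  by apply: cv2P; rewrite ?perp0E ?perp1E !mxE conjC0 ?oppr0.
have := congr1 (fun x : 'cV__ => x 0 0) h; rewrite perp0E mxE => /eqP.
rewrite oppr_eq0 conjC_eq0 => /eqP h1.
have := congr1 (fun x : 'cV__ => x 1 0) h; rewrite perp1E mxE => /eqP.
rewrite conjC_eq0 => /eqP h0.
by apply: cv2P; rewrite ?h0 ?h1 mxE.
Qed.

(** * Null vectors of positive forms *)

(** Adding the inequalities gives [c >= 0]; they then bound the modulus of [e] by [t * c] for every
    [t > 0], which fails at the [t] chosen below unless [e = 0]. *)
Lemma lin_null (e c : C) : (forall t, 0 < t -> 0 <= e + t * c) ->
  (forall t, 0 < t -> 0 <= - e + t * c) -> e = 0.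
Proof.
move=> h1 h2.
have c0 : 0 <= c.
  have := addr_ge0 (h1 1 ltr01) (h2 1 ltr01).
  by rewrite (_ : _ + _ = 2 * c); [rewrite pmulr_rge0 // ltr0n|ring].
have er : e \is Num.real.
  rewrite (_ : e = (e + 1 * c) - c); last by ring.
  by apply: rpredB; rewrite ger0_real // h1.
apply/eqP; apply: contraT => e0.
have c1 : 0 < c + 1 by rewrite ltr_wpDl.
have t0 : 0 < `|e| / (c + 1) by rewrite divr_gt0 ?normr_gt0.
have : `|e| <= `|e| / (c + 1) * c.
  rewrite real_ler_norml //; apply/andP; split; last by rewrite -subr_ge0 addrC h2.
  by rewrite lerNl -subr_ge0 opprK addrC h1.
rewrite mulrAC ler_pdivlMr // mulrDr mulr1 gerDl => /(lt_le_trans _) => /(_ 0).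
by rewrite normr_gt0 e0 ltxx => /(_ isT).
Qed.

(* Cauchy-Schwarz for a null vector of a positive form: [a] and [b] are its cross
   terms with a second vector, at which the form takes the value [c]. *)
Lemma quad_null (a b c : C) : (forall s, 0 <= s * a + s^* * b + s * s^* * c) -> a = 0 /\ b = 0.
Proof.
move=> h.
(* For [z] on the unit circle, [s = t * z] and [s = - t * z] lead to [lin_null] after division by
   [t]; the values 1 and ['i] of [z] then separate [a] from [b]. *)
have key z : z * z^* = 1 -> z * a + z^* * b = 0.
  move=> z1; apply: (@lin_null _ c) => t t0; rewrite -(pmulr_rge0 _ t0).
    have := h (t * z); rewrite rmorphM /= (geC0_conj (ltW t0)).
    suff -> : t * (z * a + z^* * b + t * c) =
      t * z * a + t * z^* * b + t * z * (t * z^*) * c by [].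
    by rewrite mulrACA z1; ring.
  have := h (- t * z); rewrite rmorphM rmorphN /= (geC0_conj (ltW t0)).
  suff -> : t * (- (z * a + z^* * b) + t * c) =
    - t * z * a + - t * z^* * b + - t * z * (- t * z^*) * c by [].
  by rewrite mulrACA z1; ring.
have e1 : a + b = 0 by rewrite -[RHS](key 1) ?conjC1 ?mul1r.
have /eqP : 'i * (a - b) = 0.
  by rewrite -[RHS](key 'i) conjCi ?mulrN -?expr2 ?sqrCi ?opprK //; ring.
rewrite mulf_eq0 (negPf (neq0Ci _)) /= subr_eq0 => /eqP ab.
move: e1; rewrite ab -mulr2n => /eqP; rewrite mulrn_eq0 /= => /eqP b0; by rewrite b0.
Qed.

(** Only the expansion of [g] is assumed, so that the lemma covers both [qf u (Phi (ou w v))] and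
    the Choi form. *)
Lemma sesq_null (V : lmodType C) (g : V -> V -> C) :
  (forall s v w, g (v + s *: w) (v + s *: w) =
    g v v + s * g w v + s^* * g v w + s * s^* * g w w) ->
  (forall v, 0 <= g v v) ->
  forall v w, g v v = 0 -> g w v = 0 /\ g v w = 0.
Proof.
move=> gE g0 v w v0; apply: (@quad_null _ _ (g w w)) => s.
by move: (g0 (v + s *: w)); rewrite gE v0 add0r.
Qed.

(** * Positive semidefinite and positive definite matrices of size 2 *)

Lemma hermP (A : M2) : Defs.hermitian A <->
  [/\ (A 0 0)^* = A 0 0, (A 1 1)^* = A 1 1 & A 1 0 = (A 0 1)^*].
Proof.
split=> [h|[a b c]].
  have e i j : (A j i)^* = A i j by rewrite -adjmxE h.
  by split; rewrite e.
by apply: mx2P; rewrite adjmxE // c conjCK.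
Qed.

Lemma dotC u v : (dot u v)^* = dot v u.
Proof. by rewrite /dot rmorphD !rmorphM /= !conjCK; ring. Qed.

Lemma qf_ou u v w : qf u (ou v w) = dot u v * dot w u.
Proof. rewrite qfE !ouE /dot; ring. Qed.

Lemma ou_psd v : psd (ou v v).
Proof.
split; first by apply/hermP; rewrite !ouE !rmorphM /= !conjCK; split; ring.
by move=> u; rewrite -/(qf u _) qf_ou -dotC mulrC mul_conjC_ge0.
Qed.

Lemma psd_qf (A : M2) u : psd A -> 0 <= qf u A. Proof. by case=> _; apply. Qed.

Lemma psdD (A X : M2) : psd A -> psd X -> psd (A + X).
Proof.
move=> [hA pA] [hX pX]; split.
  by rewrite /Defs.hermitian /adjmx map_mxD linearD /= -!/(adjmx _) hA hX.
by move=> u; rewrite -/(qf u _) linearD /= addr_ge0 ?pA ?pX.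
Qed.

Lemma pdD (A X : M2) : pd A -> psd X -> pd (A + X).
Proof.
move=> [hA pA] [hX pX]; split.
  by rewrite /Defs.hermitian /adjmx map_mxD linearD /= -!/(adjmx _) hA hX.
by move=> u u0; rewrite -/(qf u _) linearD /= ltr_wpDr ?pX ?pA.
Qed.

Lemma psd_entries (A : M2) : psd A ->
  [/\ 0 <= A 0 0, 0 <= A 1 1, A 1 0 = (A 0 1)^* & 0 <= \det A].
Proof.
move=> pA; have /hermP[_ _ h10] := pA.1.
have p a b : 0 <= qf (cv a b) A := psd_qf _ pA.
have a0 : 0 <= A 0 0.
  by have := p 1 0; rewrite qfE cv0E cv1E conjC1 conjC0 !(mul0r,mulr0,addr0,mul1r,mulr1).
split=> //.
  by have := p 0 1; rewrite qfE cv0E cv1E conjC1 conjC0 !(mul0r,mulr0,addr0,mul1r,mulr1,add0r).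
(* If [A 0 0 = 0], the first basis vector is null and the off-diagonal entries vanish; otherwise the
   vector [cv (- A 0 1) (A 0 0)] gives the form the value [A 0 0 * \det A]. *)
move: a0; rewrite le_eqVlt => /orP[/eqP a0|a0].
  suff [z _] : A 0 1 = 0 /\ A 1 0 = 0 by rewrite det2E -a0 z !mul0r subr0.
  apply: (@quad_null _ _ (A 1 1)) => s.
  have := p 1 s; rewrite qfE cv0E cv1E -a0 conjC1.
  by congr (_ <= _); ring.
rewrite -(pmulr_rge0 _ a0) det2E.
have := p (- A 0 1) (A 0 0); rewrite qfE cv0E cv1E rmorphN /= (geC0_conj (ltW a0)) -h10.
by congr (_ <= _); ring.
Qed.

(** Cholesky factorisation: [w] and [w'] are the columns of the triangular factor. When [A 0 0] is
    nonzero the second pivot is [\det A / A 0 0], which vanishes for singular [A]. *)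
Lemma psd_chol (A : M2) :
  0 <= A 0 0 -> 0 <= A 1 1 -> A 1 0 = (A 0 1)^* -> 0 <= \det A ->
  exists w w', A = ou w w + ou w' w' /\ (\det A = 0 -> w = 0 \/ w' = 0).
Proof.
rewrite le_eqVlt => /orP[/eqP a0|a0] b0 h10 d0.
  have z : A 0 1 = 0.
    have : A 0 1 * A 1 0 <= 0 by move: d0; rewrite det2E -a0 mul0r sub0r oppr_ge0.
    rewrite h10 => le0; apply/eqP; rewrite -mul_conjC_eq0 eq_le le0.
    exact: mul_conjC_ge0.
  exists 0, (cv 0 (sqrtC (A 1 1))); split; last by left.
  have r0 : 0 <= sqrtC (A 1 1) by rewrite sqrtC_ge0.
  apply: mx2P; rewrite mxE !ouE !mxE /= ?h10 ?z ?conjC0 ?mul0r ?add0r ?mulr0 -?a0 //.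
  by rewrite (geC0_conj r0) -expr2 sqrtCK.
have r0 : 0 < sqrtC (A 0 0) by rewrite sqrtC_gt0.
have rn : sqrtC (A 0 0) != 0 by rewrite gt_eqF.
have rr : sqrtC (A 0 0) * sqrtC (A 0 0) = A 0 0 by rewrite -expr2 sqrtCK.
set r := sqrtC _ in r0 rn rr.
have dd : 0 <= \det A / A 0 0 by rewrite divr_ge0 // ltW.
have t0 : 0 <= sqrtC (\det A / A 0 0) by rewrite sqrtC_ge0.
have tt : sqrtC (\det A / A 0 0) * sqrtC (\det A / A 0 0) = \det A / A 0 0 by rewrite -expr2 sqrtCK.
exists (cv r (A 1 0 / r)), (cv 0 (sqrtC (\det A / A 0 0))); split; last first.
  move=> ->; right; rewrite mul0r sqrtC0; apply: cv2P; rewrite ?cv0E ?cv1E mxE //.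
apply: mx2P; rewrite mxE !ouE !(cv0E, cv1E) ?conjC0 ?mul0r ?mulr0 ?addr0.
- by rewrite (geC0_conj (ltW r0)) rr.
- rewrite rmorphM h10 /= conjCK fmorphV /= (geC0_conj (ltW r0)); by field.
- by rewrite (geC0_conj (ltW r0)) divfK.
- rewrite (geC0_conj t0) tt rmorphM /= fmorphV /= (geC0_conj (ltW r0)) det2E -rr h10 conjCK.
  by field.
Qed.

Lemma psdP (A : M2) : psd A <->
  [/\ 0 <= A 0 0, 0 <= A 1 1, A 1 0 = (A 0 1)^* & 0 <= \det A].
Proof.
split; first exact: psd_entries.
by case=> a b c d; have [w [w' [-> _]]] := psd_chol a b c d; apply: psdD; apply: ou_psd.
Qed.

(** The orthogonal complement of a nonzero vector is a line. *)
Lemma dot_cross (w w' u : 'cV[C]_2) :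
  u != 0 -> dot u w = 0 -> dot u w' = 0 -> cross w w' = 0.
Proof.
rewrite /dot /cross => /cv2_neq0/orP[] u0 e e'; apply: (@mulfI _ (_ : C)^*).
- by rewrite conjC_eq0; exact: u0.
- rewrite mulr0; transitivity (((u 0 0)^* * w 0 0 + (u 1 0)^* * w 1 0) * w' 1 0
    - w 1 0 * ((u 0 0)^* * w' 0 0 + (u 1 0)^* * w' 1 0)); first by ring.
  by rewrite e e'; ring.
- by rewrite conjC_eq0; exact: u0.
- rewrite mulr0; transitivity (- ((u 0 0)^* * w 0 0 + (u 1 0)^* * w 1 0) * w' 0 0
    + w 0 0 * ((u 0 0)^* * w' 0 0 + (u 1 0)^* * w' 1 0)); first by ring.
  by rewrite e e'; ring.
Qed.

Lemma det_ouD w w' : \det (ou w w + ou w' w') =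
  cross w w' * (cross w w')^*.
Proof.
have E i j : (ou w w + ou w' w') i j = ou w w i j + ou w' w' i j by rewrite mxE.
by rewrite det2E !E !ouE /cross rmorphB !rmorphM /=; ring.
Qed.

(** Both Cholesky vectors are orthogonal to [u], hence parallel, and [\det A] is the squared modulus
    of their cross product. *)
Lemma null_det0 (A : M2) u : psd A -> u != 0 -> qf u A = 0 -> \det A = 0.
Proof.
move=> /psd_entries[a b c d] u0.
have [w [w' [-> _]]] := psd_chol a b c d.
rewrite linearD /= !qf_ou -[dot w u]dotC -[dot w' u]dotC => /eqP.
rewrite paddr_eq0 ?mul_conjC_ge0 // !mul_conjC_eq0 => /andP[/eqP e /eqP e'].
by rewrite det_ouD (dot_cross u0 e e') mul0r.
Qed.

Lemma psd_det_pd (A : M2) : psd A -> \det A != 0 -> pd A.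
Proof.
move=> pA d; split; first exact: pA.1.
move=> u u0; rewrite lt0r psd_qf // andbT; apply: contraNneq d => e.
exact/eqP/(null_det0 pA u0 e).
Qed.

Lemma pd_psd (A : M2) : pd A -> psd A.
Proof.
move=> [h p]; split=> // u; have [->|/p/ltW//] := eqVneq u 0.
by rewrite mulmx0 mxE.
Qed.

Lemma pd_det (A : M2) : pd A -> \det A != 0.
Proof.
move=> pA; have [a _ h _] := psd_entries (pd_psd pA).
have a0 : 0 < A 0 0.
  have := pA.2 (cv 1 0); rewrite -/(qf _ _) qfE !(cv0E,cv1E) conjC1 conjC0.
  rewrite !(mul0r,mulr0,addr0,mul1r,mulr1).
  apply; apply: contraTneq (oner_neq0 C) => /(congr1 (fun x : 'cV__ => x 0 0)).
  by rewrite cv0E mxE => ->; rewrite eqxx.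
have := pA.2 (cv (- A 0 1) (A 0 0)).
rewrite -/(qf _ _) qfE !(cv0E,cv1E) rmorphN /= (geC0_conj (ltW a0)) -h.
have -> : - A 1 0 * A 0 0 * - A 0 1 + A 0 0 * A 1 0 * - A 0 1 +
   - A 1 0 * A 0 1 * A 0 0 + A 0 0 * A 1 1 * A 0 0 = A 0 0 * \det A by rewrite det2E; ring.
move=> /(_ _)/lt0r_neq0; rewrite mulf_eq0 negb_or => H; apply: (proj2 (andP (H _))).
apply: contraTneq a0 => /(congr1 (fun x : 'cV__ => x 1 0)).
by rewrite cv1E mxE => ->; rewrite ltxx.
Qed.

Lemma psd_rank1 (A : M2) : psd A -> \det A = 0 -> exists v, A = ou v v.
Proof.
move=> /psd_entries[a b c d] d0.
have [w [w' [e h]]] := psd_chol a b c d; rewrite e; case: (h d0) => ->; [exists w'|exists w].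
  by apply: mx2P; rewrite mxE !ouE !mxE mul0r add0r.
by apply: mx2P; rewrite mxE !ouE !mxE mul0r addr0.
Qed.

(** Serves to trace a failure of strict positivity at [A] to a rank-one state. *)
Lemma psd_split (A : M2) : psd A -> A != 0 ->
  exists v X, [/\ v != 0, psd X & A = ou v v + X].
Proof.
move=> /psd_entries[a b c d] A0.
have [w [w' [e _]]] := psd_chol a b c d.
have [w0|w0] := eqVneq w 0; last by exists w, (ou w' w'); split=> //; exact: ou_psd.
exists w', (ou w w); split; [|exact: ou_psd|by rewrite addrC].
apply: contraNneq A0 => w'0; rewrite e w0 w'0.
by apply/eqP/mx2P; rewrite !mxE !big_ord1 !mxE !mul0r addr0.
Qed.

Lemma ouD v w s : ou (v + s *: w) (v + s *: w) =
  ou v v + s *: ou w v + s^* *: ou v w + (s * s^*) *: ou w w.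
Proof.
have E i : (v + s *: w) i 0 = v i 0 + s * w i 0 by rewrite !mxE.
have E4 (A1 A2 A3 A4 : M2) a b c i j :
    (A1 + a *: A2 + b *: A3 + c *: A4) i j = A1 i j + a * A2 i j + b * A3 i j + c * A4 i j.
  by rewrite !mxE.
by apply/matrixP => i j; rewrite E4 !ouE !E rmorphD rmorphM /=; ring.
Qed.

Lemma ouZ v k : ou (k *: v) (k *: v) = (k * k^*) *: ou v v.
Proof.
have E i : (k *: v) i 0 = k * v i 0 by rewrite !mxE.
have E1 (A : M2) a i j : (a *: A) i j = a * A i j by rewrite !mxE.
by apply/matrixP => i j; rewrite E1 !ouE !E rmorphM /=; ring.
Qed.

Lemma dot_gt0 v : v != 0 -> 0 < dot v v.
Proof.
rewrite /dot => /cv2_neq0/orP[] v0; [apply: ltr_pwDl|apply: ltr_wpDl];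
  by rewrite mulrC ?mul_conjC_gt0 ?mul_conjC_ge0.
Qed.

Lemma dot_perp v : dot (perp v) v = 0.
Proof. by rewrite dot_perpl crossvv. Qed.

Lemma perp_span v w : v != 0 -> exists a b, w = a *: v + b *: perp v.
Proof.
move=> v0; have d0 := lt0r_neq0 (dot_gt0 v0).
exists (dot v w / dot v v), (dot (perp v) w / dot v v).
by apply: cv2P; rewrite cv_combE /dot !(perp0E, perp1E) rmorphN /= !conjCK; field; exact: d0.
Qed.

(** Cramer's rule on each column of [z] in the basis [w], [w']; the conjugates undo the adjoint in
    [ou]. *)
Lemma ou_span (w w' : 'cV[C]_2) (z : M2) : cross w w' != 0 ->
  exists x y, z = ou w x + ou w' y.
Proof.
set d := cross w w' => d0.
exists (cv ((w' 1 0 * z 0 0 - w' 0 0 * z 1 0) / d)^* ((w' 1 0 * z 0 1 - w' 0 0 * z 1 1) / d)^*),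
       (cv ((w 0 0 * z 1 0 - w 1 0 * z 0 0) / d)^* ((w 0 0 * z 1 1 - w 1 0 * z 0 1) / d)^*).
have E (A X : M2) i j : (A + X) i j = A i j + X i j by rewrite mxE.
by apply: mx2P; rewrite E !ouE !(cv0E, cv1E) !conjCK /d /cross; field; exact: d0.
Qed.

Lemma cross_eq0 v w : v != 0 -> cross v w = 0 -> exists k, w = k *: v.
Proof.
move=> v0; have [a [b ->]] := perp_span w v0.
have -> : cross v (a *: v + b *: perp v) = b * dot v v.
  by rewrite /cross !cv_combE perp0E perp1E /dot; ring.
move=> /eqP; rewrite mulf_eq0 orbC gt_eqF ?dot_gt0 //= => /eqP ->.
by exists a; rewrite scale0r addr0.
Qed.

Lemma det0_null (A : M2) : psd A -> \det A = 0 -> exists2 u, u != 0 & qf u A = 0.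
Proof.
move=> pA /(psd_rank1 pA)[s ->]; have [->|s0] := eqVneq s 0.
  exists (cv 1 0); last by rewrite qf_ou /dot !mxE !mulr0 add0r mul0r.
  apply: contraTneq (oner_neq0 C) => /(congr1 (fun x : 'cV__ => x 0 0)).
  by rewrite cv0E mxE => ->; rewrite eqxx.
by exists (perp s); rewrite ?perp_eq0 // qf_ou dot_perp mul0r.
Qed.

Lemma det_ou v : \det (ou v v) = 0.
Proof. by rewrite det2E !ouE; ring. Qed.

Lemma psd1 : psd (1%:M : M2).
Proof.
apply/psdP; rewrite det2E !mxE /= conjC0 mulr0 subr0 mulr1 ler01; split=> //.
Qed.

(** * Orbits of a primitive map *)

Lemma mpowS (Phi : M2 -> M2) k A : mpow Phi k.+1 A = Phi (mpow Phi k A).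
Proof. by []. Qed.

Lemma mpow_linear (Phi : {linear M2 -> M2}) k : linear (mpow Phi k).
Proof. by elim: k => [//|k IH] a X Y; rewrite !mpowS IH linearP. Qed.

Lemma mpow_psd (Phi : M2 -> M2) k : M2pos_positive Phi -> M2pos_positive (mpow Phi k).
Proof. by move=> pos A pA; elim: k => [//|k IH]; rewrite mpowS; apply: pos. Qed.

(** For fixed [u], [qf u (Phi (ou w v))] is a positive semidefinite sesquilinear form in [w] and
    [v], so a null vector lies in its radical. *)
Lemma positive_null (Phi : {linear M2 -> M2}) u v w : M2pos_positive Phi ->
  qf u (Phi (ou v v)) = 0 -> qf u (Phi (ou w v)) = 0 /\ qf u (Phi (ou v w)) = 0.
Proof.
move=> pos; apply: (@sesq_null _ (fun w v => qf u (Phi (ou w v)))) => [s x y|x].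
  by rewrite ouD !(linearD, linearZ).
exact/psd_qf/pos/ou_psd.
Qed.

Section Primitive.
Variables (Phi : {linear M2 -> M2}) (k : nat).
Hypotheses (pos : M2pos_positive Phi) (k0 : (0 < k)%N)
  (strict : M2pos_strictly_positive (mpow Phi k)).

(** Split [P] into two independent rank-one states. A null vector [u] of [Phi P] is null for both
    images, so by [positive_null] and [ou_span] the functional [qf u] vanishes on the range of
    [Phi], against strictness of the [k]-th power at the identity. *)
Lemma primitive_pd P : pd P -> pd (Phi P).
Proof.
move=> pP; apply: psd_det_pd; first exact/pos/pd_psd.
apply/negP => /eqP d0; have [u u0 e] := det0_null (pos (pd_psd pP)) d0.
have [a b c d] := psd_entries (pd_psd pP).
have [w [w' [Pe _]]] := psd_chol a b c d.
have := pd_det pP; rewrite Pe det_ouD mulf_eq0 negb_or => /andP[dw _].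
have [ew ew'] : qf u (Phi (ou w w)) = 0 /\ qf u (Phi (ou w' w')) = 0.
  move: e; rewrite Pe !linearD /= => /eqP.
  rewrite paddr_eq0 ?psd_qf //; try exact/pos/ou_psd.
  by move=> /andP[/eqP ? /eqP ?].
have z X : qf u (Phi X) = 0.
  have [x [y ->]] := ou_span X dw.
  by rewrite !linearD /= (positive_null x pos ew).2 (positive_null y pos ew').2 addr0.
have i0 : (1%:M : M2) != 0.
  by apply: contra_neq (oner_neq0 C) => /(congr1 (fun x : M2 => x 0 0)); rewrite !mxE.
have := (strict psd1 i0).2 u u0.
by rewrite -(prednK k0) mpowS -/(qf u _) z ltxx.
Qed.

Lemma mpow_pd_mono A i j : (i <= j)%N -> pd (mpow Phi i A) -> pd (mpow Phi j A).
Proof.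
move=> /subnK <-; elim: (j - i)%N => [//|n IH] /IH; rewrite addSn mpowS; exact: primitive_pd.
Qed.

Lemma primitive_neq0 A : psd A -> A != 0 -> Phi A != 0.
Proof.
move=> pA A0; apply/eqP => z.
have := pd_det (strict pA A0).
have -> : mpow Phi k A = 0.
  rewrite -(prednK k0); elim: (k.-1) => [//|n IH]; by rewrite mpowS IH linear0.
by rewrite det0 eqxx.
Qed.

Lemma mpow_neq0 A n : psd A -> A != 0 -> mpow Phi n A != 0.
Proof.
move=> pA A0; elim: n => [//|n IH]; rewrite mpowS; apply: primitive_neq0 => //.
exact: mpow_psd.
Qed.

Lemma ou_neq0 v : v != 0 -> ou v v != 0.
Proof.
move=> v0; apply/eqP => /(congr1 (qf v)); rewrite qf_ou linear0 => /eqP.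
by rewrite mulf_eq0 orbb gt_eqF // dot_gt0.
Qed.

(** Split a rank-one [ou v v] off some [A] at which strictness fails. Were an iterate of [ou v v]
    positive definite by time [m], it would stay so, and adding the image of the rest would make the
    image of [A] positive definite. *)
Lemma boundary_orbit m : ~ M2pos_strictly_positive (mpow Phi m) ->
  exists2 v, v != 0 & forall j, (j <= m)%N ->
    exists w, [/\ w != 0, mpow Phi j (ou v v) = ou w w & \det (mpow Phi j (ou v v)) = 0].
Proof.
move=> ns.
have [A [pA A0 nA]] : exists A, [/\ psd A, A != 0 & ~ pd (mpow Phi m A)].
  apply: boolp.contrapT => h; apply: ns => A pA A0; apply: boolp.contrapT => n.
  by apply: h; exists A.
have [v [X [v0 pX e]]] := psd_split pA A0; exists v => // j jm.
have pj := mpow_psd j pos (ou_psd v).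
have d0 : \det (mpow Phi j (ou v v)) = 0.
  apply/eqP; apply: contraT => d; case: nA.
  have -> : mpow Phi m A = mpow Phi m (ou v v) + mpow Phi m X.
    by have := mpow_linear Phi m 1 (ou v v) X; rewrite !scale1r -e.
  apply: pdD; last exact: mpow_psd.
  by apply: (mpow_pd_mono jm); apply: psd_det_pd.
have [w we] := psd_rank1 pj d0; exists w; split=> //.
have := mpow_neq0 j (ou_psd v) (ou_neq0 v0); rewrite we; apply: contraNneq => ->.
by apply/eqP/mx2P; rewrite ouE !mxE mul0r.
Qed.

Lemma orbit_not_all_singular v : v != 0 -> (forall n, \det (mpow Phi n (ou v v)) = 0) -> False.
Proof.
by move=> v0 h; have := pd_det (strict (ou_psd v) (ou_neq0 v0)); rewrite h eqxx.
Qed.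

End Primitive.

(** * The bound 4 for positive maps *)

Section LorentzBound.
Variable Phi : {linear M2 -> M2}.

(** Polarisation at [x] of [\det (Phi x) = mu * \det x]; for fixed [mu] it is linear in [x], so it
    passes to combinations of iterates. *)
Definition conformal (mu : C) (x : M2) :=
  forall z, polar (Phi x) (Phi z) = mu * polar x z.

(** As functionals of [z], the two sides are [qf u (Phi z)] and a multiple of [qf p z]. By
    [positive_null] the first sees only the [ou p p] component of [z], as does the second; [mu] is
    the ratio there. *)
Lemma singular_conformal (v : 'cV[C]_2) : M2pos_positive Phi -> v != 0 -> \det (Phi (ou v v)) = 0 ->
  exists mu, conformal mu (ou v v).
Proof.
move=> pos v0 d0; have [s es] := psd_rank1 (pos _ (ou_psd v)) d0.
set p := perp v; set u := perp s.
have p0 : p != 0 by rewrite perp_eq0.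
have fv : qf u (Phi (ou v v)) = 0 by rewrite es qf_ou dot_perp mul0r.
have pp := lt0r_neq0 (dot_gt0 p0).
exists (qf u (Phi (ou p p)) / (dot p p * dot p p)) => z.
rewrite es !polar_ou -/u -/p.
have dz : cross v p != 0.
  rewrite (_ : cross v p = dot v v); first exact: lt0r_neq0 (dot_gt0 v0).
  by rewrite /cross perp0E perp1E /dot; ring.
have [x [y ->]] := ou_span z dz; have [a [b ->]] := perp_span y v0.
have -> : ou p (a *: v + b *: p) = a^* *: ou p v + b^* *: ou p p.
  by apply/matrixP => i j; rewrite !mxE !big_ord1 !mxE rmorphD !rmorphM /=; ring.
rewrite !(linearD, linearZ) /= (positive_null x pos fv).2 (positive_null p pos fv).1.
have pv : dot p v = 0 by exact: dot_perp.
have vp : dot v p = 0 by rewrite -dotC pv conjC0.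
by rewrite !qf_ou pv vp; field; exact: pp.
Qed.

Lemma polar_comb a x y z : polar (a *: x + y) z = a * polar x z + polar y z.
Proof. by rewrite polarC linearP /= ![polar z _]polarC. Qed.

Lemma conformal0 mu : conformal mu 0.
Proof. by move=> z; rewrite linear0 ![polar 0 _]polarC !linear0 mulr0. Qed.

Lemma conformal_comb mu a x y :
  conformal mu x -> conformal mu y -> conformal mu (a *: x + y).
Proof. by move=> hx hy z; rewrite linearP !polar_comb hx hy; ring. Qed.

Lemma conformalZ mu a x : conformal mu x -> conformal mu (a *: x).
Proof. by move=> hx; rewrite -[_ *: _]addr0; apply: conformal_comb (conformal0 mu). Qed.

Lemma conformalD mu x y : conformal mu x -> conformal mu y -> conformal mu (x + y).
Proof. by move=> hx hy; rewrite -[x]scale1r; apply: conformal_comb. Qed.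

(** Evaluating each equation at the other state gives [mu = nu] by symmetry, unless the pairing
    vanishes; the pairing is the squared modulus of [cross v w], so [w] is then a multiple of
    [v]. *)
Lemma conformal_uniform mu nu v w : v != 0 -> w != 0 ->
  conformal mu (ou v v) -> conformal nu (ou w w) -> conformal mu (ou w w).
Proof.
move=> v0 w0 hv hw; have [e|ne] := eqVneq (polar (ou v v) (ou w w)) 0; last first.
  have : mu * polar (ou v v) (ou w w) = nu * polar (ou v v) (ou w w).
    by rewrite -hv polarC hw polarC.
  by move/(mulIf ne) => ->.
move: e; rewrite polar_ou qf_ou => e.
have [|k ->] := @cross_eq0 v w v0; last by rewrite ouZ; apply: conformalZ.
by apply/eqP; rewrite -dot_perpl -mul_conjC_eq0 dotC e.
Qed.

Lemma mpow_lin_mx k A : mxvec A *m lin_mx Phi ^+ k = mxvec (mpow Phi k A).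
Proof.
elim: k => [|k IH]; first by rewrite expr0 mulmx1.
by rewrite exprSr mulmxA IH mul_vec_lin.
Qed.

(** Cayley-Hamilton on the four-dimensional space [M2]: the characteristic polynomial is monic of
    degree 4. *)
Lemma linear_recurrence : exists c : 'I_(4%N) -> C,
  forall A, mpow Phi 4%N A = \sum_(i < 4%N) c i *: mpow Phi i A.
Proof.
pose p := char_poly (lin_mx Phi : 'M[C]_(2 * 2)).
exists (fun i => - p`_i) => A.
have := Cayley_Hamilton (lin_mx Phi : 'M[C]_(2 * 2)).
rewrite -/p => /(congr1 (fun X : 'M[C]_(2 * 2) => vec_mx (mxvec A *m X) : M2)).
rewrite mulmx0 linear0 -[p in horner_mx _ p]coefK.
have sp : size p = 5%N by rewrite size_char_poly.
rewrite sp poly_def big_ord_recr /=.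
have -> : p`_4%N = 1.
  have /monicP := char_poly_monic (lin_mx Phi : 'M[C]_(2 * 2)).
  by rewrite lead_coefE size_char_poly.
rewrite scale1r rmorphD /= mulmxDr linearD /= rmorphXn /= horner_mx_X mpow_lin_mx mxvecK.
move=> /eqP; rewrite addrC addr_eq0 => /eqP H; etransitivity; first exact: H.
rewrite rmorph_sum /= mulmx_sumr linear_sum -sumrN; apply: eq_bigr => i _.
rewrite linearZ /= rmorphXn /= horner_mx_X -scalemxAr linearZ /=.
by rewrite mpow_lin_mx mxvecK scaleNr.
Qed.

Lemma conformal_orbit mu A : (forall j, (j < 4)%N -> conformal mu (mpow Phi j A)) ->
  forall n, conformal mu (mpow Phi n A).
Proof.
(* The induction carries a window of four consecutive iterates, which the recurrence shifts by
   one. *)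
move=> h; suff : forall n j, (j < 4)%N -> conformal mu (mpow Phi (n + j) A).
  by move=> H n; rewrite -[n]addn0; apply: H.
elim=> [//|n IH] j; rewrite ltnS leq_eqVlt => /orP[/eqP -> | j3]; last first.
  by rewrite addSnnS; apply: IH.
have [c hc] := linear_recurrence.
have -> : mpow Phi (n.+1 + 3) A = \sum_(i < 4%N) c i *: mpow Phi (n + i) A.
  rewrite addSnnS addnC /mpow iterD -/(mpow _ _ _) hc.
  by apply: eq_bigr => i _; rewrite addnC /mpow iterD.
apply: (big_ind (conformal mu)) => [|x y|i _].
- exact: conformal0.
- exact: conformalD.
- by apply/conformalZ/IH.
Qed.

Lemma conformal_det mu A : \det A = 0 ->
  (forall n, conformal mu (mpow Phi n A)) -> forall n, \det (mpow Phi n A) = 0.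
Proof.
move=> d0 h; elim=> [//|n IH].
have := h n (mpow Phi n A); rewrite !polar_self IH !mulr0 => /eqP.
by rewrite mulf_eq0 pnatr_eq0 => /eqP.
Qed.

Lemma positive_exponent_le4 (k : nat) : M2pos_positive Phi -> (0 < k)%N ->
  M2pos_strictly_positive (mpow Phi k) -> M2pos_strictly_positive (mpow Phi 4%N).
Proof.
move=> pos k0 strict; apply: boolp.contrapT => /(boundary_orbit pos k0 strict)[v v0 orb].
apply: (orbit_not_all_singular strict v0).
(* Iterate [j] is conformal because iterate [j.+1] is singular too; singularity up to time 4 yields
   the four equations that the recurrence needs. *)
have cj j : (j < 4)%N -> exists w mu,
    [/\ w != 0, mpow Phi j (ou v v) = ou w w & conformal mu (ou w w)].
  move=> j4; have [w [w0 e _]] := orb j (ltnW j4).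
  have [_ [_ _ d]] := orb j.+1 j4.
  have [|mu hmu] := @singular_conformal w pos w0; first by rewrite -e.
  by exists w, mu.
have [mu hmu] : exists mu, conformal mu (ou v v).
  by apply: singular_conformal => //; have [_ [_ _ d]] := orb 1%N isT.
apply: (@conformal_det mu); first exact: det_ou.
apply: conformal_orbit => j /cj[w [nu [w0 -> hnu]]].
exact: (conformal_uniform v0 w0 hmu hnu).
Qed.

End LorentzBound.

(** * Block matrices and the Choi form *)

Lemma adjmxD (m n : nat) (A X : 'M[C]_(m, n)) : adjmx (A + X) = adjmx A + adjmx X.
Proof. by rewrite /adjmx map_mxD linearD. Qed.

Lemma adjmxZ (m n : nat) a (A : 'M[C]_(m, n)) : adjmx (a *: A) = a^* *: adjmx A.
Proof. by rewrite /adjmx map_mxZ linearZ. Qed.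

Lemma psd_mxblock (n : nat) (X : 'I_n -> 'I_n -> M2) :
  psd (\mxblock_(i < n, j < n) X i j) <->
  (forall i j, adjmx (X j i) = X i j) /\
  (forall w : 'I_n -> 'cV[C]_2, 0 <= \sum_i \sum_j sesq (w i) (X i j) (w j)).
Proof.
have E (w : 'I_n -> 'cV[C]_2) :
    (adjmx (\mxcol_i w i) *m (\mxblock_(i < n, j < n) X i j) *m (\mxcol_i w i)) 0 0 =
    \sum_i \sum_j sesq (w i) (X i j) (w j).
  have -> : adjmx (\mxcol_i w i) = \mxrow_i adjmx (w i).
    by apply/matrixP => i j; rewrite !mxE.
  rewrite mul_mxrow_mxblock mul_mxrow_mxcol summxE exchange_big /=.
  apply: eq_bigr => j _; rewrite mulmx_suml summxE; exact: eq_bigr.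
have H : adjmx (\mxblock_(i < n, j < n) X i j) = \mxblock_(i < n, j < n) adjmx (X j i).
  by apply/matrixP => i j; rewrite !mxE.
split=> [[h p]|[h p]]; split.
- by apply/eq_mxblockP; rewrite -H.
- by move=> w; rewrite -E.
- by rewrite /Defs.hermitian H; apply/eq_mxblockP.
- by move=> v; rewrite -[v]submxcolK E.
Qed.

Section Choi.
Variable Phi : {linear M2 -> M2}.

(** The form of the Choi matrix, with blocks [Phi (delta_mx i j)]. A vector made of two blocks is
    encoded as the matrix with these columns; the form is linear in [T] and conjugate-linear in
    [S]. *)
Definition choi (T S : M2) : C :=
  \sum_i \sum_j sesq (col i S) (Phi (delta_mx i j)) (col j T).

Lemma choiE s (v w : M2) : choi (v + s *: w) (v + s *: w) =
  choi v v + s * choi w v + s^* * choi v w + s * s^* * choi w w.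
Proof.
have t i j (X := Phi (delta_mx i j)) :
    sesq (col i (v + s *: w)) X (col j (v + s *: w)) =
    sesq (col i v) X (col j v) + s * sesq (col i v) X (col j w)
    + s^* * sesq (col i w) X (col j v) + s * s^* * sesq (col i w) X (col j w).
  have E (Y Z : 'M[C]_1) a : (Y + a *: Z) 0 0 = Y 0 0 + a * Z 0 0 by rewrite !mxE.
  have cE l : col l (v + s *: w) = col l v + s *: col l w by rewrite linearD linearZ.
  rewrite /sesq !cE !adjmxD !adjmxZ !mulmxDl !mulmxDr.
  by rewrite -!(scalemxAl, scalemxAr) !mxE; ring.
by rewrite /choi !sum2E !t; ring.
Qed.

(** The columns of [ou u v] are multiples of [u] by the conjugate entries of [v], so the double sum
    reassembles [Phi (ou v v)] from matrix units. *)
Lemma choi_ou u v : choi (ou u v) (ou u v) = qf u (Phi (ou v v)).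
Proof.
have c i : col i (ou u v) = (v i 0)^* *: u.
  by apply/matrixP => k l; rewrite mxE ouE mxE mulrC (ord1 l).
rewrite [in RHS](matrix_sum_delta (ou v v)) linear_sum linear_sum /choi.
apply: eq_bigr => i _; rewrite linear_sum linear_sum; apply: eq_bigr => j _.
rewrite /sesq !c adjmxZ conjCK linearZ /= linearZ /= ouE /qf.
by rewrite -!(scalemxAl, scalemxAr) !mxE mulrA [_^* * _]mulrC.
Qed.

Hypothesis cp : completely_positive Phi.

(** Complete positivity is applied to the block matrix of matrix units, whose form at [w] is the
    squared modulus of [\sum_i w i i 0]. *)
Lemma choi_ge0 T : 0 <= choi T T.
Proof.
have /psd_mxblock[_ h] : psd (\mxblock_(i < 2, j < 2) Phi (delta_mx i j)).
  apply: cp; apply/psd_mxblock; split=> [i j|w].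
    by apply/matrixP => k l; rewrite !mxE andbC conjC_nat.
  have e i j : sesq (w i) (delta_mx i j) (w j) = (w i i 0)^* * w j j 0.
    rewrite /sesq -(mul_delta_mx (0 : 'I_1)) mulmxA -colE -mulmxA -rowE.
    by rewrite !mxE big_ord1 !mxE.
  under eq_bigr do under eq_bigr do rewrite e.
  rewrite !sum2E -!mulrDr -mulrDl -rmorphD mulrC; exact: mul_conjC_ge0.
exact: (h (fun i => col i T)).
Qed.

End Choi.

(** * The bound 3 for completely positive maps *)

Section CPBound.
Variable Phi : {linear M2 -> M2}.
Hypothesis cp : completely_positive Phi.

Definition choi_null (T : M2) := choi Phi T T = 0.

(** The null vectors of a positive semidefinite form are its radical, a subspace. *)
Lemma choi_nullD T S s : choi_null T -> choi_null S -> choi_null (T + s *: S).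
Proof.
move=> nT nS; have [e1 e2] := @sesq_null _ _ (choiE Phi) (choi_ge0 cp) _ S nT.
by rewrite /choi_null choiE nT nS e1 e2 !mulr0 !addr0.
Qed.

Lemma choi_nullZ T s : choi_null T -> choi_null (s *: T).
Proof.
move=> nT; rewrite -[_ *: _]add0r; apply: choi_nullD => //.
rewrite /choi_null /choi big1 // => i _; rewrite big1 // => j _.
by rewrite /sesq !linear0 mxE.
Qed.

Lemma choi_null_parallel u v w : cross v w != 0 ->
  choi_null (ou u v) -> choi_null (ou u w) -> forall x, choi_null (ou u x).
Proof.
move=> d nv nw x; have [a [b ->]] := cross_span x d.
have -> : ou u (a *: v + b *: w) = a^* *: ou u v + b^* *: ou u w.
  by apply/matrixP => i j; rewrite !mxE !big_ord1 !mxE rmorphD !rmorphM /=; ring.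
by apply: choi_nullD => //; apply: choi_nullZ.
Qed.

Lemma choi_null_cross u u' v w : u != 0 -> u' != 0 -> cross v w != 0 ->
  choi_null (ou u v) -> choi_null (ou u' w) -> cross u u' = 0 ->
  forall x, choi_null (ou u x).
Proof.
move=> u0 u'0 d nv nw /(cross_eq0 u0)[k e].
have k0 : k != 0 by apply: contraNneq u'0 => k0; rewrite e k0 scale0r.
apply: (choi_null_parallel d nv).
have -> : ou u w = k^-1 *: ou u' w by rewrite e /ou -scalemxAl scalerA mulVf ?scale1r.
exact: choi_nullZ.
Qed.

Lemma choi_null_all (u v : 'I_3 -> 'cV[C]_2) :
  (forall i, u i != 0) -> (forall i j, i != j -> cross (v i) (v j) != 0) ->
  (forall i, choi_null (ou (u i) (v i))) ->
  forall x, x != 0 -> exists2 y, y != 0 & choi_null (ou y x).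
Proof.
move=> u0 dv n x x0.
have par i j : i != j -> cross (u i) (u j) = 0 -> exists2 y, y != 0 & choi_null (ou y x).
  move=> ij e; exists (u i) => //.
  exact: (choi_null_cross (u0 i) (u0 j) (dv i j ij) (n i) (n j) e).
pose i0 : 'I_3 := ord0; pose i1 : 'I_3 := lift ord0 ord0; pose i2 : 'I_3 := ord_max.
have [/par h|d01] := eqVneq (cross (u i0) (u i1)) 0; first exact: h.
have [/par h|d02] := eqVneq (cross (u i2) (u i0)) 0; first exact: h.
have [/par h|d12] := eqVneq (cross (u i2) (u i1)) 0; first exact: h.
(* From here on the [u i] are pairwise independent, as the [v i] are, so all of [al], [be], [ga],
   [de] are nonzero. *)
have [al [be e2]] := cross_span (u i2) d01.
have [ga [de f2]] := cross_span (v i2) (dv i0 i1 isT).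
have [p [r xe]] := cross_span x (dv i0 i1 isT).
have al0 : al != 0.
  by apply: contraNneq d12 => z; rewrite e2 cross_comb z crossvv mul0r mulr0 addr0.
have be0 : be != 0.
  by apply: contraNneq d02 => z; rewrite e2 cross_comb z crossvv mul0r mulr0 addr0.
have ga0 : ga != 0.
  have := dv i2 i1 isT; apply: contraNneq => z.
  by rewrite f2 cross_comb z crossvv mul0r mulr0 addr0.
have de0 : de != 0.
  have := dv i2 i0 isT; apply: contraNneq => z.
  by rewrite f2 cross_comb z crossvv mul0r mulr0 addr0.
exists ((al * de^* * p^*) *: u i0 + (be * ga^* * r^*) *: u i1).
  (* Crossing with [u i1] or [u i0] isolates one coefficient, and [p] and [r] are not both zero. *)
  have [p0|p0] := eqVneq p 0; last first.
    apply/eqP => /(congr1 (cross^~ (u i1))); rewrite cross_comb crossvv mulr0 addr0.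
    rewrite {2}/cross !mxE !mul0r subr0 => /eqP.
    by rewrite !mulf_eq0 !conjC_eq0 (negPf al0) (negPf de0) (negPf p0) (negPf d01).
  have r0 : r != 0 by apply: contraNneq x0 => r0; rewrite xe p0 r0 !scale0r addr0.
  apply/eqP => /(congr1 (cross^~ (u i0))); rewrite cross_comb crossvv mulr0 add0r.
  rewrite {2}/cross !mxE !mul0r subr0 crossC mulrN => /eqP.
  by rewrite oppr_eq0 !mulf_eq0 !conjC_eq0 (negPf be0) (negPf ga0) (negPf r0) (negPf d01).
(* [u2 v2^*] puts the combination [al de^* u0 v1^* + be ga^* u1 v0^*] into the
   kernel; [y] is chosen so that the cross terms of [y x^*] are a multiple of it. *)
have -> : ou ((al * de^* * p^*) *: u i0 + (be * ga^* * r^*) *: u i1) x =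
  (p^* * r^*) *: ou (u i2) (v i2)
  + (al * de^* * p^* * p^* - p^* * r^* * al * ga^*) *: ou (u i0) (v i0)
  + (be * ga^* * r^* * r^* - p^* * r^* * be * de^*) *: ou (u i1) (v i1).
  have E3 a b c (X Y Z : M2) i j :
      (a *: X + b *: Y + c *: Z) i j = a * X i j + b * Y i j + c * Z i j.
    by rewrite !mxE.
  apply/matrixP => i j; rewrite E3 !ouE xe e2 f2 !cv_combE !rmorphD !rmorphM /=; ring.
apply: choi_nullD; last exact: n.
by apply: choi_nullD; [apply: choi_nullZ|]; apply: n.
Qed.

(** Lowering the exponent by the period [p] only rescales the iterate, so strong induction ends in
    the initial range. *)
Lemma periodic_det A (i p : nat) c : (0 < p)%N ->
  mpow Phi (p + i) A = c *: mpow Phi i A ->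
  (forall m, (m < p + i)%N -> \det (mpow Phi m A) = 0) ->
  forall m, \det (mpow Phi m A) = 0.
Proof.
move=> p0 e small m; have [n] := ubnP m; elim: n m => // n IH m mn.
have [/small//|ge] := ltnP m (p + i).
have -> : mpow Phi m A = c *: mpow Phi (m - p) A.
  have l k X : mpow Phi k (c *: X) = c *: mpow Phi k X.
    by elim: k => [//|k IHk]; rewrite !mpowS IHk linearZ.
  rewrite -{1}(subnK ge) {1}/mpow iterD -!/(mpow _ _ _) e l /mpow -iterD.
  by rewrite subnDA subnK // -(leq_add2l p) subnKC // (leq_trans _ ge) // leq_addr.
rewrite detZ IH ?mulr0 //; apply: leq_trans (_ : m <= n)%N; last by rewrite -ltnS.
by rewrite ltn_subrL p0 (leq_trans _ ge) // ltn_addr.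
Qed.

Lemma cp_exponent_le3 (k : nat) : M2pos_positive Phi -> (0 < k)%N ->
  M2pos_strictly_positive (mpow Phi k) -> M2pos_strictly_positive (mpow Phi 3%N).
Proof.
move=> pos k0 strict; apply: boolp.contrapT => /(boundary_orbit pos k0 strict)[v v0 orb].
apply: (orbit_not_all_singular strict v0).
(* States are recorded at times 0, 1, 2; singularity at time 3 gives the last of them its Choi null
   vector. *)
have /boolp.choice[w hw] : forall i : 'I_3, exists w, w != 0 /\ mpow Phi i (ou v v) = ou w w.
  by move=> i; have [w [? ? _]] := orb i (ltnW (ltn_ord i)); exists w.
have d i : (i <= 3)%N -> \det (mpow Phi i (ou v v)) = 0 by move=> /orb[? []].
(* If two recorded states are proportional, the orbit is periodic up to scaling. *)
have [[i [j [ij e]]]|ne] :=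
  boolp.pselect (exists i j : 'I_3, (i < j)%N /\ cross (w i) (w j) = 0).
  have [wi0 ei] := hw i; have [wj0 ej] := hw j.
  have [t wt] := cross_eq0 wi0 e.
  apply: (@periodic_det _ i (j - i) (t * t^*)); rewrite ?subn_gt0 // subnK ?(ltnW ij) //.
    by rewrite ei ej wt ouZ.
  by move=> m mj; apply/d/ltnW/(ltn_trans mj).
have /boolp.choice[u hu] : forall i : 'I_3, exists u, u != 0 /\ choi_null (ou u (w i)).
  move=> i; have [wi0 ei] := hw i.
  have [|u u0 qu] := det0_null (pos _ (ou_psd (w i))); last first.
    by exists u; rewrite /choi_null choi_ou.
  by have := d i.+1 (ltn_ord i); rewrite mpowS ei.
have dw i j : i != j -> cross (w i) (w j) != 0.
  move=> ij; apply/eqP => e; apply: ne.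
  have [lt|lt|/val_inj eq] := ltngtP i j; first by exists i, j.
    by exists j, i; rewrite crossC e oppr0.
  by rewrite eq eqxx in ij.
have all := choi_null_all (fun i => (hu i).1) dw (fun i => (hu i).2).
elim=> [|n IH]; first exact: det_ou.
have pn := mpow_psd n pos (ou_psd v).
have [s es] := psd_rank1 pn IH.
have s0 : s != 0.
  have := mpow_neq0 pos k0 strict n (ou_psd v) (ou_neq0 v0).
  rewrite es; apply: contraNneq => ->.
  by apply/eqP/mx2P; rewrite ouE !mxE mul0r.
have [y y0] := all s s0; rewrite /choi_null choi_ou -es => q.
by rewrite mpowS; apply: null_det0 q; first exact: pos.
Qed.

End CPBound.

(** * Maps attaining the bounds *)

Definition mx2 (a b c d : C) : M2 :=
  \matrix_(i, j) (if i == 0 then if j == 0 then a else b else if j == 0 then c else d).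

Lemma mx2E a b c d :
  ((mx2 a b c d 0 0 = a) * (mx2 a b c d 0 1 = b) *
   (mx2 a b c d 1 0 = c) * (mx2 a b c d 1 1 = d))%type.
Proof. by rewrite !mxE. Qed.

Lemma psd_trace_gt0 (A : M2) : psd A -> A != 0 -> 0 < A 0 0 + A 1 1.
Proof.
move=> pA A0; have [v [X [v0 pX ->]]] := psd_split pA A0.
have [x0 x1 _ _] := psd_entries pX.
have E i : (ou v v + X) i i = ou v v i i + X i i by rewrite mxE.
rewrite !E !ouE addrACA ltr_wpDr ?addr_ge0 //.
by have := dot_gt0 v0; rewrite /dot ![_^* * _]mulrC.
Qed.

Lemma psd_delta : psd (delta_mx 0 0 : M2).
Proof. by apply/psdP; rewrite det2E !mxE /= conjC0 !mulr0 subr0 ler01; split. Qed.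

Lemma delta_neq0 : (delta_mx 0 0 : M2) != 0.
Proof.
by apply: contra_neq (oner_neq0 C) => /(congr1 (fun X : M2 => X 0 0)); rewrite !mxE.
Qed.

(** A nonzero positive semidefinite matrix has positive trace, so the first condition gives
    strictness of the [n]-th power; the first diagonal matrix unit defeats the lower powers. *)
Lemma exponent_criterion (Phi : M2 -> M2) (n : nat) : M2pos_positive Phi -> (0 < n)%N ->
  (forall A, \det (mpow Phi n A) = 0 -> psd A -> A 0 0 + A 1 1 = 0) ->
  (forall j, (0 < j < n)%N -> \det (mpow Phi j (delta_mx 0 0)) = 0) ->
  M2pos_primitive Phi /\ exponent_is Phi n.
Proof.
move=> pos n0 h1 h2.
have s : M2pos_strictly_positive (mpow Phi n).
  move=> A pA A0; apply: psd_det_pd; first exact: mpow_psd.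
  by apply/eqP => /h1 /(_ pA) t; have := psd_trace_gt0 pA A0; rewrite t ltxx.
split; first by split=> //; exists n.
split=> // j j0 jn sj; have := pd_det (sj _ psd_delta delta_neq0).
by rewrite h2 ?eqxx // j0.
Qed.

Definition shift_dephase (A : M2) : M2 :=
  let c := (A 0 1 + A 1 0) / 2 in
  mx2 (A 1 1) (A 1 1 + 'i * c) (A 1 1 - 'i * c) (A 0 0 + A 1 1).

Lemma mulCii : 'i * 'i = -1 :> C. Proof. by rewrite -expr2 sqrCi. Qed.

Lemma det_shift_dephase A : \det (shift_dephase A) = A 0 0 * A 1 1 - ((A 0 1 + A 1 0) / 2) ^+ 2.
Proof.
rewrite det2E /shift_dephase !mx2E /=; set c := _ / 2.
transitivity (A 0 0 * A 1 1 + 'i * 'i * c ^+ 2); first by ring.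
by rewrite mulCii; ring.
Qed.

(** The determinant of the image of [A] depends only on the two diagonal entries and the
    off-diagonal mean; one step sends such a triple [(a, d, c)] to [(d, a + d, d)]. *)
Lemma shift_dephase_entries A : let X := shift_dephase A in
  [/\ X 0 0 = A 1 1, X 1 1 = A 0 0 + A 1 1 & (X 0 1 + X 1 0) / 2 = A 1 1].
Proof. by rewrite /= /shift_dephase !mx2E; split=> //; field. Qed.

Lemma shift_dephase_linear : linear shift_dephase.
Proof.
have E (X Y : M2) a i j : (a *: X + Y) i j = a * X i j + Y i j by rewrite !mxE.
by move=> a X Y; apply: mx2P; rewrite E /shift_dephase !mx2E !E; field.
Qed.

Lemma shift_dephase_herm : herm_preserving shift_dephase.
Proof.
move=> A /hermP[a d z]; apply/hermP; rewrite /shift_dephase !mx2E.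
rewrite !rmorphD /= !rmorphM /= !rmorphD /= conjCi fmorphV /= conjC_nat z conjCK a d.
by split=> //; ring.
Qed.

Lemma shift_dephase_positive : M2pos_positive shift_dephase.
Proof.
move=> A pA; have [a d z e] := psd_entries pA; have h := shift_dephase_herm pA.1.
apply/psdP; have [_ _ zz] := (hermP _).1 h.
have [-> -> _] := shift_dephase_entries A; split; [exact: d|exact: addr_ge0|exact: zz|].
rewrite det_shift_dephase.
(* For Hermitian [A] the mean is the real part of [A 0 1]; dropping the imaginary part adds its
   square to the determinant. *)
have -> : A 0 0 * A 1 1 - ((A 0 1 + A 1 0) / 2) ^+ 2 =
    \det A + (A 0 1 - A 1 0) / 2 * ((A 0 1 - A 1 0) / 2)^*.
  by rewrite det2E rmorphM rmorphB /= z conjCK fmorphV /= conjC_nat; field.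
by rewrite addr_ge0 ?mul_conjC_ge0.
Qed.

Lemma shift_dephase_exponent : M2pos_primitive shift_dephase /\ exponent_is shift_dephase 4%N.
Proof.
apply: exponent_criterion => // [|A|j].
- exact: shift_dephase_positive.
- rewrite !mpowS det_shift_dephase.
  have [-> -> ->] := shift_dephase_entries (mpow shift_dephase 2%N A).
  rewrite !mpowS.
  have [-> -> _] := shift_dephase_entries (shift_dephase (mpow shift_dephase 0%N A)).
  have [-> -> _] := shift_dephase_entries (mpow shift_dephase 0%N A).
  rewrite /mpow /= => e pA; have [a d _ _] := psd_entries pA.
  (* The third iterate has the triple [(a + 2 d, 2 a + 3 d, a + 2 d)], so the next determinant is
     [(a + d) (a + 2 d)]. *)
  have /eqP : (A 0 0 + A 1 1) * (A 0 0 + A 1 1 + A 1 1) = 0 by rewrite -[RHS]e; ring.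
  rewrite mulf_eq0 => /orP[/eqP//|].
  by rewrite paddr_eq0 ?addr_ge0 // => /andP[/eqP].
- case: j => [|[|[|[|j]]]] // _; rewrite !mpowS det_shift_dephase /mpow /=.
  + by rewrite !mxE /=; ring.
  + have [-> -> ->] := shift_dephase_entries (delta_mx 0 0).
    by rewrite !mxE /=; ring.
  + have [-> -> ->] := shift_dephase_entries (shift_dephase (delta_mx 0 0)).
    have [-> -> _] := shift_dephase_entries (delta_mx 0 0).
    by rewrite !mxE /=; ring.
Qed.

Definition measure_prepare (A : M2) : M2 := mx2 (A 1 1) (A 1 1) (A 1 1) (A 0 0 + A 1 1).

Lemma det_measure_prepare A : \det (measure_prepare A) = A 0 0 * A 1 1.
Proof. by rewrite det2E /measure_prepare !mx2E; ring. Qed.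

Lemma measure_prepare_linear : linear measure_prepare.
Proof.
have E (X Y : M2) a i j : (a *: X + Y) i j = a * X i j + Y i j by rewrite !mxE.
by move=> a X Y; apply: mx2P; rewrite E /measure_prepare !mx2E !E //; ring.
Qed.

(** The Kraus decomposition with operators [e1 e0^*] and [f e1^*], whose adjoints are applied to [x]
    and [y]. *)
Lemma measure_prepare_kraus x A y : sesq x (measure_prepare A) y =
  sesq (cv (x 1 0) 0) A (cv (y 1 0) 0)
  + sesq (cv 0 (x 0 0 + x 1 0)) A (cv 0 (y 0 0 + y 1 0)).
Proof.
by rewrite !sesqE /measure_prepare !mx2E !(cv0E, cv1E) rmorph0 rmorphD /=; ring.
Qed.

Lemma measure_prepare_cp : completely_positive measure_prepare.
Proof.
move=> n X /psd_mxblock[h p]; apply/psd_mxblock; split=> [i j|w].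
  have e k l : (X j i k l)^* = X i j l k by rewrite -(h i j) adjmxE.
  by apply: mx2P; rewrite adjmxE /measure_prepare !mx2E ?rmorphD /= ?e.
under eq_bigr => i _ do (under eq_bigr => j _ do rewrite measure_prepare_kraus; rewrite big_split).
rewrite big_split /=; apply: addr_ge0.
  exact: (p (fun i => cv (w i 1 0) 0)).
exact: (p (fun i => cv 0 (w i 0 0 + w i 1 0))).
Qed.

Lemma measure_prepare_positive : M2pos_positive measure_prepare.
Proof.
move=> A pA; have [a d _ _] := psd_entries pA.
apply/psdP; rewrite det_measure_prepare /measure_prepare !mx2E (geC0_conj d).
by rewrite addr_ge0 // mulr_ge0.
Qed.

Lemma measure_prepare_exponent : M2pos_primitive measure_prepare /\ exponent_is measure_prepare 3%N.
Proof.
apply: exponent_criterion => // [|A|j].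
- exact: measure_prepare_positive.
(* The diagonal evolves by [(a, d)] to [(d, a + d)], and each determinant is the product of the
   previous diagonal; the third one is [(a + d) (a + 2 d)]. *)
- rewrite !mpowS det_measure_prepare /mpow /measure_prepare /= !mx2E => /eqP e pA.
  have [a d _ _] := psd_entries pA.
  move: e; rewrite mulf_eq0 => /orP[/eqP//|].
  by rewrite addrC paddr_eq0 ?addr_ge0 // => /andP[/eqP].
- case: j => [|[|[|j]]] // _; rewrite !mpowS det_measure_prepare /mpow /measure_prepare /=;
    by rewrite ?mx2E !mxE /=; ring.
Qed.

Local Close Scope ring_scope.

Theorem theorem10 :
  max_exponent_is lin_herm_maps 4 /\ max_exponent_is cp_maps 3.
Proof.
split; split.
- move=> Phi [lin _] [pos _] k [k0 sk min]; rewrite leqNgt; apply/negP => lt.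
  pose F := HB.pack_for {linear M2 -> M2} Phi (GRing.isLinear.Build _ _ _ _ Phi lin).
  exact: (min 4 isT lt (@positive_exponent_le4 F k pos k0 sk)).
- have [prim ex] := shift_dephase_exponent; exists shift_dephase; split=> //.
  by split; [exact: shift_dephase_linear|exact: shift_dephase_herm].
- move=> Phi [lin cp] [pos _] k [k0 sk min]; rewrite leqNgt; apply/negP => lt.
  pose F := HB.pack_for {linear M2 -> M2} Phi (GRing.isLinear.Build _ _ _ _ Phi lin).
  exact: (min 3 isT lt (@cp_exponent_le3 F cp k pos k0 sk)).
- have [prim ex] := measure_prepare_exponent; exists measure_prepare; split=> //.
  by split; [exact: measure_prepare_linear|exact: measure_prepare_cp].
Qed.
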